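(* Let $\mathcal{M}$ be a realized matroid over $\mathbb{Z}$ on the ground set $[n]$. Then $\operatorname{Gr}\mathcal{M}$ is a disjoint union of $m(\emptyset)=\#G_\emptyset$ simplicial posets, each isomorphic to $\operatorname{link}_{\operatorname{Gr}\mathcal{M}}(\emptyset,e)$, where $e$ is the identity element of $C_\emptyset$.
   Context: A matroid over $\mathbb{Z}$ on $[n]=\{1,\dots,n\}$ assigns to each $A\subseteq[n]$ a finitely generated abelian group $\mathcal{M}(A)$ (up to isomorphism). It is realized if a list $z_1,\dots,z_n\in\mathcal{M}(\emptyset)$ is fixed with $\mathcal{M}(A)=\mathcal{M}(\emptyset)/(z_i : i\in A)$ for all $A$. Write $\mathcal{M}(A)\cong\mathbb{Z}^{d(A)}\times G_A$ with $G_A$ finite (the torsion subgroup), and $C_A=\operatorname{Hom}(G_A,\mathbb{C}^* )$ its dual group. For $A\subseteq[n]$ and $b\notin A$, the canonical projection $\pi_{(A,b)}:\mathcal{M}(A)\to\mathcal{M}(A\cup\{b\})$ is the quotient map by the image of $z_b$; it sends $G_A$ into $G_{A\cup\{b\}}$, and the dual map $\pi^{(A,b)}:C_{A\cup\{b\}}\to C_A$ is $h\mapsto h\circ\pi_{(A,b)}|_{G_A}$. The set of torsions $\operatorname{Gr}\mathcal{M}$ is the set of pairs $(A,l)$ with $A\subseteq[n]$, $d(\emptyset)-d(A)=\#A$ and $l\in C_A$. For $(A\cup\{b\},h),(A,l)\in\operatorname{Gr}\mathcal{M}$ with $b\notin A$, we say $(A\cup\{b\},h)$ covers $(A,l)$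 if $\pi^{(A,b)}(h)=l$; $\operatorname{Gr}\mathcal{M}$ is partially ordered by the reflexive–transitive closure of this covering relation. For an element $\sigma$ of a poset $P$, $\operatorname{link}_P(\sigma)=\{\tau\in P:\sigma\le\tau\}$ with the induced order. A finite poset with a unique minimal element $\hat 0$ is simplicial if for every element $\sigma$ the interval $[\hat0,\sigma]$ is isomorphic to a Boolean lattice. *)

(* Defs.v *)
From HB Require Import structures.
From Stdlib Require Import Relation_Operators.
From mathcomp Require Import all_boot all_order all_algebra.
From mathcomp Require Import ring_quotient.
From mathcomp Require Import boolp classical_sets functions cardinality reals.
From mathcomp Require Import complex.

Set Implicit Arguments.
Unset Strict Implicit.
Unset Printing Implicit Defensive.

Import Order.TTheory GRing.Theory Num.Theory.
Local Open Scope ring_scope.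
Local Open Scope quotient_scope.

Definition finitely_generated (V : zmodType) : Prop :=
  exists s : seq V, forall x, exists c : 'I_(size s) -> int,
    x = \sum_(i < size s) s`_i *~ c i.

Definition torsion (V : zmodType) : {pred V} :=
  fun x => `[< exists2 k : nat, (0 < k)%N & x *+ k = 0 >].

Lemma torsion_zmod_closed (V : zmodType) : zmod_closed (@torsion V).
Proof.
split=> [|x y /asboolP[k k0 xk] /asboolP[l l0 yl]]; apply/asboolP.
  by exists 1%N.
exists (k * l)%N; first by rewrite muln_gt0 k0.
by rewrite mulrnBl mulrnA xk mul0rn mulnC mulrnA yl mul0rn subr0.
Qed.

HB.instance Definition _ (V : zmodType) :=
  GRing.isZmodClosed.Build V (@torsion V) (@torsion_zmod_closed V).

Record torsion_subgroup (V : zmodType) := TorsionElt {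
  tval :> V;
  tvalP : tval \in @torsion V }.

HB.instance Definition _ (V : zmodType) := [isSub for @tval V].
HB.instance Definition _ (V : zmodType) :=
  [Choice of torsion_subgroup V by <:].
HB.instance Definition _ (V : zmodType) :=
  [SubChoice_isSubZmodule of torsion_subgroup V by <:].

(* The exponent d of a decomposition V ~ Z^d x G, with G the torsion subgroup;
   it exists and is unique when V is finitely generated. *)
Definition free_rank (V : zmodType) : nat :=
  xget 0%N [set d : nat |
    exists f : {additive V -> ('rV[int]_d * torsion_subgroup V)%type},
      bijective f]%classic.

(* Homomorphisms from G to the multiplicative group of nonzero complex numbers. *)
Record dual (R : realType) (G : zmodType) := Dual {
  dval :> G -> R[i];
  dual_neq0 : forall x, dval x != 0;
  dualD : forall x y, dval (x + y) = dval x * dval y }.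

Lemma dual1_neq0 (R : realType) (G : zmodType) (x : G) : (1 : R[i]) != 0.
Proof. exact: oner_neq0. Qed.

Lemma dual1D (R : realType) (G : zmodType) (x y : G) : (1 : R[i]) = 1 * 1.
Proof. by rewrite mulr1. Qed.

Definition dual1 (R : realType) (G : zmodType) : dual R G :=
  Dual (dual1_neq0 R (G := G)) (@dual1D R G).

Section DualMap.
Variables (R : realType) (G H : zmodType) (f : {additive G -> H}) (h : dual R H).

Lemma dual_map_neq0 x : h (f x) != 0.
Proof. exact: dual_neq0. Qed.

Lemma dual_mapD x y : h (f (x + y)) = h (f x) * h (f y).
Proof. by rewrite raddfD dualD. Qed.

Definition dual_map : dual R G := Dual dual_map_neq0 dual_mapD.
End DualMap.

(* [ambient] is the group attached to the empty set; [module] below recovers it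
   up to isomorphism as the quotient by the trivial subgroup. *)
Record realized_matroid (n : nat) := RealizedMatroid {
  ambient : zmodType;
  ambient_fg : finitely_generated ambient;
  elt : 'I_n -> ambient }.

Section RealizedMatroid.
Variables (n : nat) (M : realized_matroid n).
Implicit Types (A : {set 'I_n}) (b : 'I_n).

Definition subgroup_gen A : {pred ambient M} :=
  fun x => `[< exists c : 'I_n -> int, x = \sum_(i in A) elt M i *~ c i >].

Lemma subgroup_gen_zmod_closed A : zmod_closed (subgroup_gen A).
Proof.
split=> [|x y /asboolP[c ->] /asboolP[d ->]]; apply/asboolP.
  by exists (fun=> 0); rewrite big1.
exists (fun i => c i - d i); rewrite -sumrB.
by apply: eq_bigr => i _; rewrite mulrzBr.
Qed.

HB.instance Definition _ A := GRing.isZmodClosed.Build (ambient M)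
  (subgroup_gen A) (subgroup_gen_zmod_closed A).

Definition module A : zmodType := Quotient.quot (subgroup_gen A).

Definition proj_fun A b (x : module A) : module (b |: A) :=
  \pi_(Quotient.quot (subgroup_gen (b |: A))) (repr x).

Lemma subgroup_genS A b x : x \in subgroup_gen A -> x \in subgroup_gen (b |: A).
Proof.
move=> /asboolP[c ->]; apply/asboolP.
exists (fun i => if i \in A then c i else 0).
rewrite big_mkcond [RHS]big_mkcond; apply: eq_bigr => i _.
by rewrite in_setU1; case: ifP => iA; rewrite ?orbT //= mulr0z if_same.
Qed.

Lemma proj_pi A b (x : ambient M) :
  proj_fun b (\pi_(Quotient.quot (subgroup_gen A)) x) =
  \pi_(Quotient.quot (subgroup_gen (b |: A))) x.
Proof.
apply/eqP; rewrite /proj_fun -Quotient.idealrBE; apply: subgroup_genS.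
by rewrite Quotient.idealrBE reprK.
Qed.

Lemma proj_is_zmod_morphism A b : zmod_morphism (@proj_fun A b).
Proof.
move=> x y; rewrite -[x]reprK -[y]reprK.
by rewrite -(raddfB \pi_(Quotient.quot (subgroup_gen A))) !proj_pi raddfB.
Qed.

HB.instance Definition _ A b := GRing.isZmodMorphism.Build _ _ (@proj_fun A b)
  (@proj_is_zmod_morphism A b).

Definition tors A : zmodType := torsion_subgroup (module A).

Lemma proj_torsion A b (x : tors A) :
  proj_fun b (tval x) \in @torsion (module (b |: A)).
Proof.
case: x => x /= /asboolP[k k0 xk]; apply/asboolP; exists k => //.
by rewrite -raddfMn xk raddf0.
Qed.

Definition tors_proj A b (x : tors A) : tors (b |: A) :=
  TorsionElt (proj_torsion b x).

Lemma tors_proj_is_zmod_morphism A b : zmod_morphism (@tors_proj A b).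
Proof. by move=> x y; apply: val_inj; rewrite /= !raddfB. Qed.

HB.instance Definition _ A b := GRing.isZmodMorphism.Build _ _ (@tors_proj A b)
  (@tors_proj_is_zmod_morphism A b).

Definition independent A : Prop :=
  (free_rank (module finset.set0))%:Z - (free_rank (module A))%:Z = #|A|%:Z.

Lemma independent0 : independent finset.set0.
Proof. by rewrite /independent cards0 subrr. Qed.

Variable R : realType.

Record Gr := MkGr {
  gr_set : {set 'I_n};
  gr_char : dual R (tors gr_set);
  gr_indep : independent gr_set }.

Inductive covers : Gr -> Gr -> Prop :=
  Covers A b (h : dual R (tors (b |: A))) (l : dual R (tors A))
      (Ab_indep : independent (b |: A)) (A_indep : independent A) of
      b \notin A & dual_map (@tors_proj A b) h = l :
    covers (MkGr h Ab_indep) (MkGr l A_indep).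

Definition gr_le (x y : Gr) : bool :=
  `[< clos_refl_trans Gr (fun u v => covers v u) x y >].

HB.instance Definition _ := gen_eqMixin Gr.
HB.instance Definition _ := gen_choiceMixin Gr.

Lemma gr_le_eqVcard x y : gr_le x y -> x = y \/ (#|gr_set x| < #|gr_set y|)%N.
Proof.
move=> /asboolP; elim=> {x y} [_ _ [A b h l ? ? bA _]|x|x y z _ xy _ yz].
- by right; rewrite /= cardsU1 bA.
- by left.
case: xy => [->//|xy]; case: yz => [<-|yz]; first by right.
by right; apply: ltn_trans yz.
Qed.

Lemma gr_le_refl : reflexive gr_le.
Proof. by move=> x; apply/asboolP; apply: rt_refl. Qed.

Lemma gr_le_anti : antisymmetric gr_le.
Proof.
move=> x y /andP[/gr_le_eqVcard[//|xy] /gr_le_eqVcard[//|yx]].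
by have := ltn_trans xy yx; rewrite ltnn.
Qed.

Lemma gr_le_trans : transitive gr_le.
Proof.
move=> y x z /asboolP xy /asboolP yz; apply/asboolP.
exact: rt_trans xy yz.
Qed.

Fact gr_display : Order.disp_t. Proof. exact: Order.Disp tt tt. Qed.

HB.instance Definition _ := Order.Le_isPOrder.Build gr_display Gr
  gr_le_refl gr_le_anti gr_le_trans.

Definition gr_id : Gr := MkGr (dual1 R (tors finset.set0)) independent0.

End RealizedMatroid.

(* Below, a subset of a partially ordered type stands for the poset it forms
   with the induced order. *)

Local Open Scope classical_set_scope.

Definition order_iso d (T : porderType d) d' (T' : porderType d')
    (P : set T) (Q : set T') : Prop :=
  exists2 f : T -> T', set_bij P Q f &
    forall x y, P x -> P y -> (f x <= f y)%O = (x <= y)%O.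

Section Subposets.
Context d (T : porderType d).
Implicit Types (P : set T) (x y : T).

Definition link x : set T := [set y | (x <= y)%O].

Definition minimal_elt P x : Prop :=
  P x /\ forall y, P y -> (y <= x)%O -> y = x.

Definition interval_in P x y : set T :=
  [set t | [/\ P t, (x <= t)%O & (t <= y)%O]].

Definition boolean P : Prop :=
  exists k : nat, exists2 f : T -> {set 'I_k}, set_bij P setT f &
    forall x y, P x -> P y -> (f x \subset f y) = (x <= y)%O.

Definition simplicial P : Prop :=
  finite_set P /\
  exists o, [/\ minimal_elt P o,
    forall o', minimal_elt P o' -> o' = o &
    forall s, P s -> boolean (interval_in P o s)].

Definition poset_disjoint_union (I : Type) (P : I -> set T) : Prop :=
  [/\ \bigcup_i P i = setT,
      trivIset setT P &
      forall i j x y, P i x -> P j y -> (x <= y)%O -> i = j].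

End Subposets.

(* Main.v *)
From HB Require Import structures.
From Stdlib Require Import Relation_Operators.
Require Import Defs.
From mathcomp Require Import all_boot all_order all_algebra.
From mathcomp Require Import boolp classical_sets functions cardinality reals.
From mathcomp Require Import ring_quotient complex trigo separable cyclotomic.

Set Implicit Arguments.
Unset Strict Implicit.
Unset Printing Implicit Defensive.

Import Order.TTheory GRing.Theory Num.Theory.

Local Open Scope classical_set_scope.
Local Open Scope card_scope.
Local Open Scope ring_scope.
Local Open Scope quotient_scope.

(** An element (A, l) of Gr M is a character of the saturation of the subgroup
    generated by the [z i], i in A, that is trivial on the [z i]; comparability
    is restriction. So the elements below (A, l) are the restrictions of l to
    the subsets of A, which gives Boolean intervals, and the links of the
    elements (∅, χ) partition Gr M. There are #G_∅ of them since a finite abelian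
    group has as many characters as elements.

    To identify the link of (∅, χ) with that of (∅, e), one multiplies by
    characters ψ_A extending χ, trivial on the [z i] with i in A, and compatible
    under restriction. Extend χ to a character of the whole group through a
    retraction onto its torsion subgroup and write its value at [z i] as
    exp(√-1 a_i). On v with k v = Σ_(i ∈ A) c_i z_i put
    ψ_A(v) = χ(v) exp(- √-1 Σ a_i c_i / k): since A is independent, the rational
    coordinates c_i / k of v are unique, hence additive in v and unchanged when
    A is enlarged. *)

(** * Characters of finite abelian groups *)

Section CharacterCount.
Variables (R : realType) (G : zmodType).

Lemma dual_eqP (h k : dual R G) : (forall x, h x = k x) -> h = k.
Proof.
case: h k => [h h0 hD] [k k0 kD] /= /funext hk; subst k.
by congr Dual; exact: Prop_irrelevance.
Qed.

Lemma dual0 (h : dual R G) : h 0 = 1.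
Proof.
by apply: (mulfI (dual_neq0 h 0)); rewrite -dualD addr0 mulr1.
Qed.

Variables (m' : nat).
Local Notation m := m'.+1.
Variables (g : 'I_m -> G) (idx : G -> 'I_m).
Hypotheses (gK : cancel g idx) (idxK : cancel idx g).

(** Translation by [x] acting on row vectors in the regular representation, with basis indexed
    through [g]. *)
Definition regular_mx (x : G) : 'M[R[i]]_m :=
  \matrix_(i, j) (g j == g i + x)%:R.

Lemma regular_mx0 : regular_mx 0 = 1.
Proof.
apply/matrixP => i j; rewrite !mxE addr0 (can_eq gK) eq_sym.
by case: eqP.
Qed.

Lemma regular_mxD x y : regular_mx (x + y) = regular_mx x * regular_mx y.
Proof.
apply/matrixP => i j; rewrite !mxE (bigD1 (idx (g i + x))) //= big1 => [|k kN].
  by rewrite !mxE idxK eqxx mul1r addr0 addrA.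
rewrite !mxE; case: eqP => [gk|]; last by rewrite mul0r.
by move: kN; rewrite -gk gK eqxx.
Qed.

Lemma regular_mxMn x k : regular_mx (x *+ k) = regular_mx x ^+ k.
Proof.
elim: k => [|k IH]; first by rewrite mulr0n expr0 regular_mx0.
by rewrite mulrS exprS regular_mxD IH.
Qed.

(* Translation by [x] permutes the group, so it does not change the sum of all
   elements. *)
Lemma mulrn_card (x : G) : x *+ m = 0.
Proof.
have bij : {on [pred _ | true], bijective (fun i => idx (g i + x))}.
  exists (fun i => idx (g i - x)) => i _ /=.
    by rewrite idxK addrK gK.
  by rewrite idxK subrK gK.
have : \sum_i g i = \sum_i (g i + x).
  by rewrite (reindex _ bij); apply: eq_bigr => i _; rewrite idxK.
rewrite big_split /= sumr_const card_ord -[X in X = _ -> _]addr0.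
by move/addrI.
Qed.

(** By [mulrn_card] the matrix is annihilated by X^m - 1, which splits over [R[i]] with simple
    roots. *)
Lemma regular_mx_diagonalizable x : mxred.diagonalizable (regular_mx x).
Proof.
apply/mxred.diagonalizableP.
have [rs rsE] := closed_field_poly_normal ('X^m - 1 : {poly R[i]}).
have mon : lead_coef ('X^m - 1 : {poly R[i]}) = 1.
  by apply/eqP; rewrite -[_ == _]/(_ \is monic) monicXnsubC.
rewrite mon scale1r in rsE; exists rs.
  by rewrite -separable_prod_XsubC -rsE separable_Xn_sub_1 // pnatr_eq0.
rewrite -rsE; apply: mxminpoly_min.
rewrite rmorphB /= rmorphXn /= horner_mx_X rmorph1.
by rewrite -regular_mxMn mulrn_card regular_mx0 subrr.
Qed.

Lemma regular_mx_codiagonalizable : exists2 P : 'M[R[i]]_m, P \in unitmx &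
  exists D : G -> 'rV[R[i]]_m, forall x, P *m regular_mx x = diag_mx (D x) *m P.
Proof.
have [|P Pu /allP diagP] := (mxred.codiagonalizableP
    [seq regular_mx (g i) | i <- enum 'I_m]).1.
  split=> [_ _ /mapP[i _ ->] /mapP[j _ ->]|_ /mapP[i _ ->]].
    by rewrite /comm_mx !(mulmxE, =^~ regular_mxD) addrC.
  exact: regular_mx_diagonalizable.
exists P => //.
suff /choice[D DP] : forall x, exists D : 'rV[R[i]]_m,
    P *m regular_mx x = diag_mx D *m P by exists D.
move=> x.
have /diagP : regular_mx x \in [seq regular_mx (g i) | i <- enum 'I_m].
  by apply/mapP; exists (idx x); rewrite ?mem_enum ?idxK.
by move=> /mxred.similar_diagPex[D] /(mxred.similarP Pu); exists D.
Qed.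

(* A common eigenbasis of the regular representation is a basis of characters:
   each character is a common eigenvector, hence occurs in it, and a repetition
   would make the translations linearly dependent. *)
Lemma dual_enumeration : exists chi : 'I_m -> dual R G, bijective chi.
Proof.
have [P Pu [D DP]] := regular_mx_codiagonalizable.
have diagD x : diag_mx (D x) = P *m regular_mx x *m invmx P.
  by rewrite DP mulmxK.
have D0 : diag_mx (D 0) = 1%:M by rewrite diagD regular_mx0 mulmx1 mulmxV.
have DD x y : diag_mx (D (x + y)) = diag_mx (D x) *m diag_mx (D y).
  by rewrite !diagD regular_mxD -mulmxE !mulmxA mulmxKV.
have coefM j x y : D (x + y) 0 j = D x 0 j * D y 0 j.
  have /matrixP/(_ j j) := DD x y; rewrite mul_diag_mx !mxE eqxx !mulr1n.
  by [].
have coef_neq0 j x : D x 0 j != 0.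
  have /matrixP/(_ j j) := D0; rewrite -(subrr x) !mxE eqxx mulr1n coefM.
  by apply: contra_eq_neq => ->; rewrite mul0r eq_sym oner_eq0.
pose chi j := Dual (coef_neq0 j) (coefM j).
(* The hypothesis is a relation [u] between the diagonalized translations. Undoing the change of
   basis, the translations satisfy it too, and row [idx 0] of that combination is [u] itself. *)
have indep (u : 'I_m -> R[i]) :
    (forall i, \sum_l D (g l) 0 i * u l = 0) -> forall l, u l = 0.
  move=> uD a.
  have : \sum_l u l *: regular_mx (g l) = 0.
    have -> : \sum_l u l *: regular_mx (g l) =
        invmx P *m (\sum_l u l *: diag_mx (D (g l))) *m P.
      rewrite mulmx_sumr mulmx_suml; apply: eq_bigr => l _.
      by rewrite -scalemxAr -scalemxAl diagD !mulmxA mulVmx // mul1mx mulmxKV.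
    suff -> : \sum_l u l *: diag_mx (D (g l)) = 0 by rewrite mulmx0 mul0mx.
    apply/matrixP => i l; rewrite summxE mxE.
    case: (eqVneq i l) => [<-|iNl]; last first.
      by rewrite big1 // => q _; rewrite !mxE (negbTE iNl) mulr0n mulr0.
    rewrite -[RHS](uD i); apply: eq_bigr => q _.
    by rewrite !mxE eqxx mulr1n mulrC.
  move=> /matrixP/(_ (idx 0) a); rewrite summxE mxE.
  rewrite (bigD1 a) //= big1 => [|l lNa]; last first.
    by rewrite !mxE idxK add0r (can_eq gK) eq_sym (negbTE lNa) mulr0.
  by rewrite !mxE idxK add0r eqxx mulr1 addr0.
have chi_inj : injective chi.
  move=> j k jk; apply/eqP; apply: contraT => jNk.
  (* [C] is the character table. Two equal rows make it singular, and a nonzero column of its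
     cokernel is a relation excluded by [indep]. *)
  pose C := \matrix_(i, l) D (g l) 0 i : 'M[R[i]]_m.
  have : \rank (cokermx C) != 0%N.
    rewrite mxrank_coker subn_eq0 -ltnNge ltn_neqAle rank_leq_row andbT.
    rewrite -/(row_free C) row_free_unit unitmxE unitfE negbK.
    apply/eqP/(determinant_alternate jNk) => l.
    by rewrite !mxE -[LHS]/(chi j (g l)) jk.
  rewrite mxrank_eq0 => /negP; case; apply/eqP/matrixP => a b.
  rewrite [RHS]mxE; apply: (indep (fun l => cokermx C l b)) => i.
  have /matrixP/(_ i b) := mulmx_coker C; rewrite !mxE.
  by under eq_bigr do rewrite mxE.
have chi_surj h : exists j, chi j = h.
  (* [v] is a common eigenvector of the translations with eigenvalues [h x]; a nonzero coordinate of
     it in the eigenbasis singles out the [chi j] equal to [h]. *)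
  pose v : 'rV[R[i]]_m := \row_l h (- g l).
  have vE x : v *m regular_mx x = h x *: v.
    apply/rowP => j; rewrite !mxE (bigD1 (idx (g j - x))) //= big1 => [|l lN].
      by rewrite !mxE idxK subrK eqxx mulr1 addr0 opprB dualD.
    rewrite !mxE; case: eqP => [gj|]; last by rewrite mulr0.
    by move: lN; rewrite gj addrK gK eqxx.
  pose w := v *m invmx P.
  have wE x : w *m diag_mx (D x) = h x *: w.
    by rewrite diagD !mulmxA mulmxKV // vE -scalemxAl.
  have [|/rV0Pn[j wj]] := eqVneq w 0.
    move/(congr1 (mulmx^~ P)); rewrite mulmxKV // mul0mx => /rowP/(_ 0).
    by rewrite !mxE => /eqP; rewrite (negbTE (dual_neq0 _ _)).
  exists j; apply: dual_eqP => x; have /rowP/(_ j) := wE x.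
  by rewrite mul_mx_diag [LHS]mxE [RHS]mxE mulrC => /(mulIf wj).
have /choice[idc idcK] := chi_surj.
by exists chi; exists idc => // j; apply: chi_inj.
Qed.

End CharacterCount.

Section FiniteDual.
Variables (R : realType) (G : zmodType).

Lemma dual_enumeration_card m : [set: G] #= `I_m ->
  exists chi : 'I_m -> dual R G, bijective chi.
Proof.
move=> /card_set_bijP[f [fim finj fsurj]].
have f_lt x : (f x < m)%N by exact: fim.
case: m f_lt {fim} fsurj => [|m] f_lt fsurj; first by have := f_lt 0.
have /choice[g gE] (i : 'I_m.+1) : exists x, f x = i.
  by have [|x _ fx] := fsurj i; [exact: ltn_ord|exists x].
apply: (@dual_enumeration R G m g (fun x => Ordinal (f_lt x))) => [i|x].
  by apply: val_inj; rewrite /= gE.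
by apply: finj; rewrite ?in_setT ?gE.
Qed.

Lemma dual_finite : finite_set [set: G] -> finite_set [set: dual R G].
Proof.
move=> /finite_setP[m /dual_enumeration_card[chi [idc _ chiK]]].
apply: (sub_finite_set _ (finite_image chi (@finite_finset _ setT))) => h _.
by exists (idc h).
Qed.

End FiniteDual.

(** * The unit circle *)

Section UnitCircle.
Variable R : realType.
Implicit Types a b : R.

Definition expi a : R[i] := (cos a +i* sin a)%C.

Lemma expi0 : expi 0 = 1.
Proof. by rewrite /expi cos0 sin0. Qed.

Lemma expiD a b : expi (a + b) = expi a * expi b.
Proof. by rewrite /expi cosD sinD; simpc; rewrite [sin a * _ + _]addrC. Qed.

Lemma expi_neq0 a : expi a != 0.
Proof.
apply/eqP => a0; have := expiD a (- a); rewrite subrr expi0 a0 mul0r.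
by apply/eqP; rewrite oner_eq0.
Qed.

Lemma expiN a : expi (- a) = (expi a)^-1.
Proof.
by apply: (mulfI (expi_neq0 a)); rewrite -expiD subrr expi0 divff ?expi_neq0.
Qed.

(** Since [c] has modulus 1, [acos] of its real part is its argument up to sign, and the sign of the
    imaginary part decides. *)
Lemma root_of_unity_expi (c : R[i]) k : (0 < k)%N -> c ^+ k = 1 ->
  exists a, expi a = c.
Proof.
move=> k0 ck.
have : `|c| = 1.
  by apply/eqP; rewrite -(@pexpr_eq1 _ `|c| k) // -normrX ck normr1.
move/(congr1 (fun x => x ^+ 2)); rewrite expr1n -add_Re2_Im2.
case: c {ck} => x y /= [/eqP xy].
have y2 : y ^+ 2 = 1 - x ^+ 2 by rewrite -(eqP xy) addrC addKr.
have x1 : -1 <= x <= 1.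
  rewrite -ler_norml -(@expr_le1 _ 2) // -normrX ger0_norm ?sqr_ge0 //.
  by rewrite -subr_ge0 -y2 sqr_ge0.
have cosx : cos (acos x) = x by exact: (acos_def x1).2.
have sinx : sin (acos x) = `|y| by rewrite sin_acos // -y2 sqrtr_sqr.
have [y0|y0] := leP 0 y.
  by exists (acos x); rewrite /expi cosx sinx ger0_norm.
by exists (- acos x); rewrite /expi cosN sinN cosx sinx ltr0_norm // opprK.
Qed.

End UnitCircle.

(** * Finitely generated abelian groups *)

(** Maps produced by [choice] carry no structure; this bundles them as morphisms. *)
Lemma additive_of (U V : zmodType) (f : U -> V) :
  zmod_morphism f -> exists g : {additive U -> V}, forall x, g x = f x.
Proof.
move=> fB; pose a := GRing.isZmodMorphism.Build _ _ f fB.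
by exists (HB.pack_for {additive U -> V} f a).
Qed.

Lemma mulrz_Mn (V : zmodType) (x : V) (c : int) k :
  x *~ (c *+ k) = x *~ c *+ k.
Proof. by rewrite -mulr_natr natz mulrzA -pmulrn. Qed.

Lemma torsionP (V : zmodType) (x : V) :
  reflect (exists2 k : nat, (0 < k)%N & x *+ k = 0) (x \in @torsion V).
Proof. exact: asboolP. Qed.

Lemma torsion_int_row d (y : 'rV[int]_d) : y \in @torsion _ -> y = 0.
Proof.
move=> /torsionP[k k0 yk]; apply/rowP => j; rewrite mxE.
have /rowP/(_ j) := yk; rewrite mulmxnE mxE => /eqP.
by rewrite mulrn_eq0 eqn0Ngt k0 => /eqP.
Qed.

Lemma raddf_torsion (U V : zmodType) (f : {additive U -> V}) x :
  x \in @torsion U -> f x \in @torsion V.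
Proof.
move=> /torsionP[k k0 xk]; apply/torsionP; exists k => //.
by rewrite -raddfMn xk raddf0.
Qed.

Lemma row_denominator d (u : 'rV[rat]_d) :
  exists2 k : nat, (0 < k)%N &
    exists w : 'rV[int]_d, k%:R *: u = map_mx intr w.
Proof.
pose K := \prod_j denq (u 0 j).
have K0 : 0 < K by apply: prodr_gt0 => j _; exact: denq_gt0.
exists `|K|%N; first by rewrite absz_gt0 gt_eqF.
exists (\row_j (numq (u 0 j) * \prod_(i | i != j) denq (u 0 i))).
apply/rowP => j; rewrite !mxE natr_absz gtr0_norm // /K (bigD1 j) //=.
by rewrite !intrM numqE [LHS]mulrAC [u 0 j * _]mulrC.
Qed.

Lemma intr_map_mx_inj m d :
  injective (map_mx intr : 'M[int]_(m, d) -> 'M[rat]_(m, d)).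
Proof.
move=> A B /matrixP AB; apply/matrixP => i j.
by have := AB i j; rewrite !mxE => /intr_inj.
Qed.

Lemma id_sub_is_zmod_morphism (V : zmodType) (f : {additive V -> V}) :
  zmod_morphism (fun v => v - f v).
Proof.
move=> x y; rewrite raddfB !opprB [LHS]addrACA [RHS]addrACA.
by rewrite [- y - _]addrC.
Qed.

Section Presentation.
Variables (V : zmodType) (s : seq V).

Definition lin_comb (c : 'rV[int]_(size s)) : V :=
  \sum_(i < size s) s`_i *~ c 0 i.

Lemma lin_comb_is_zmod_morphism : zmod_morphism lin_comb.
Proof.
move=> c d; rewrite /lin_comb -sumrB; apply: eq_bigr => i _.
by rewrite !mxE mulrzBr.
Qed.

HB.instance Definition _ :=
  GRing.isZmodMorphism.Build _ _ lin_comb lin_comb_is_zmod_morphism.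

Local Notation ratm := (map_mx (intr : int -> rat)).

(* The relation lattice is only used up to finite index: a matrix of relations
   of maximal rank spans it rationally. *)
Lemma max_relations : exists t (B : 'M[int]_(t, size s)),
  (forall c, lin_comb c = 0 -> (ratm c <= ratm B)%MS) /\
  (forall c, (ratm c <= ratm B)%MS -> lin_comb c \in @torsion V).
Proof.
pose rel r := `[< exists t (B : 'M[int]_(t, size s)),
  (forall u, lin_comb (u *m B) = 0) /\ \rank (ratm B) = r >].
have ex_rel : exists r, rel r.
  exists 0%N; apply/asboolP; exists 0%N, 0; split=> [u|].
    by rewrite mulmx0 raddf0.
  by rewrite map_mx0 mxrank0.
have rel_le r : rel r -> (r <= size s)%N.
  by move=> /asboolP[t [B [_ <-]]]; exact: rank_leq_col.
case: (ex_maxnP ex_rel rel_le) => r /asboolP[t [B [KB rB]]] rmax.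
exists t, B; split=> [c c0|c /submxP[u cE]].
  (* Adjoining the row [c] still gives a matrix of relations, so by maximality the rank does not
     grow and [c] lies in the rational row space of [B]. *)
  have sub : (ratm B <= ratm (col_mx B c))%MS.
    by rewrite map_col_mx -addsmxE addsmxSl.
  have : (\rank (ratm (col_mx B c)) <= \rank (ratm B))%N.
    rewrite rB; apply: rmax; apply/asboolP; exists (t + 1)%N, (col_mx B c).
    split=> // u; rewrite -[u]hsubmxK mul_row_col raddfD /= KB add0r.
    rewrite [rsubmx u]mx11_scalar mul_scalar_mx /lin_comb.
    under eq_bigr do rewrite mxE mulrC mulrzA.
    by rewrite -mulrz_suml [\sum_i _]c0 mul0rz.
  have := mxrank_leqif_sup sub; move=> leqBc; rewrite (geq_leqif leqBc).
  by rewrite map_col_mx -addsmxE addsmx_sub => /andP[].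
have [k k0 [w wE]] := row_denominator u.
apply/torsionP; exists k => //; rewrite -raddfMn.
have -> : c *+ k = w *m B; last exact: KB.
apply: intr_map_mx_inj; rewrite map_mxM -wE -scalemxAl -cE.
by apply/matrixP => i j; rewrite !mxE mulmxnE rmorphMn /= mulr_natl.
Qed.

(* In Smith coordinates of the relation matrix, the free quotient is read off
   from the zero columns. *)
Lemma saturated_quotient t (B : 'M[int]_(t, size s)) :
  exists d (Q : 'M[int]_(size s, d)),
    (forall y : 'rV_d, exists c, c *m Q = y) /\
    (forall c : 'rV_(size s), c *m Q = 0 <-> (ratm c <= ratm B)%MS).
Proof.
have [L Lu [U Uu [d _ BE]]] := int_Smith_normal_form B.
set D := \matrix_(_, _) _ in BE.
(* [J] lists the zero columns of the Smith form and [E] selects them. *)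
pose J := [set j | [forall i, D i j == 0]]%SET.
pose E : 'M[int]_(size s, #|J|) := \matrix_(i, k) (i == enum_val k)%:R.
have DE0 : D *m E = 0.
  apply/matrixP => i k; rewrite mxE [RHS]mxE.
  rewrite (bigD1 (enum_val k)) //= big1 => [|j jk]; last first.
    by rewrite [E _ _]mxE (negbTE jk) mulr0.
  have := enum_valP k; rewrite inE => /forallP/(_ i)/eqP ->.
  by rewrite mul0r addr0.
exists #|J|, (invmx U *m E); split=> [y|c].
  exists (y *m E^T *m U); rewrite mulmxA mulmxK // -mulmxA.
  suff -> : E^T *m E = 1%:M by rewrite mulmx1.
  apply/matrixP => k l; rewrite !mxE (bigD1 (enum_val k)) //= big1 => [|j jk].
    by rewrite !mxE eqxx mul1r addr0 (inj_eq enum_val_inj).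
  by rewrite !mxE (negbTE jk) mul0r.
split=> [|/submxP[u cE]]; last first.
  apply: intr_map_mx_inj; rewrite map_mxM cE -mulmxA -map_mxM BE.
  by rewrite mulmxA mulmxK // -mulmxA DE0 mulmx0 !map_mx0 mulmx0.
rewrite mulmxA; set y := c *m invmx U => yE.
have {yE} yJ j : j \in J -> y 0 j = 0.
  move=> jJ; have /rowP/(_ (enum_rank_in jJ j)) := yE.
  rewrite mxE [RHS]mxE (bigD1 j) //= big1 => [|i ij]; last first.
    by rewrite [E _ _]mxE enum_rankK_in // (negbTE ij) mulr0.
  by rewrite [E _ _]mxE enum_rankK_in // eqxx mulr1 addr0.
have yD : (ratm y <= ratm D)%MS.
  rewrite (row_sum_delta (ratm y)); apply: summx_sub => j _.
  have [jJ|] := boolP (j \in J); first by rewrite mxE yJ // scale0r sub0mx.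
  rewrite inE negb_forall => /existsP[i Dij]; apply: scalemx_sub.
  have ij : i = j :> nat.
    by apply/eqP; apply: contraNT Dij => /negbTE ij; rewrite mxE ij mulr0n.
  (* The nonzero entry of column [j] is diagonal, hence alone in its row, so that row is a multiple
     of the unit vector. *)
  have -> : delta_mx 0 j = (D i j)%:~R^-1 *: row i (ratm D) :> 'rV[rat]_(size s).
    apply/rowP => l; rewrite !mxE ij eqxx /= eq_sym.
    have [->|jl] := eqVneq l j.
      move: Dij; rewrite mxE ij !eqxx mulr1n => di.
      by rewrite mulVf // intr_eq0.
    by rewrite -val_eqE eq_sym in jl; rewrite (negbTE jl) mulr0n mulr0.
  by apply: scalemx_sub; exact: row_sub.
have -> : ratm c = ratm y *m ratm U by rewrite -map_mxM mulmxKV.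
apply: (submx_trans (submxMr _ yD)).
have -> : ratm D *m ratm U = ratm (invmx L) *m ratm B.
  by rewrite -!map_mxM BE -!mulmxA mulKmx.
exact: submxMl.
Qed.

End Presentation.

Section FinitelyGenerated.
Variable V : zmodType.
Hypothesis fgV : finitely_generated V.

(** Any choice of integral coordinates [c v] works: two choices differ by a relation, which [Q]
    kills. *)
Lemma fg_free_quotient : exists d (phi : {additive V -> 'rV[int]_d}),
  (forall y, exists v, phi v = y) /\ (forall v, phi v = 0 -> v \in @torsion V).
Proof.
have [s gen] := fgV.
have /choice[c cK] v : exists c, lin_comb (s := s) c = v.
  have [c ->] := gen v; exists (\row_i c i).
  by apply: eq_bigr => i _; rewrite mxE.
have [t [B [relB torB]]] := max_relations s.
have [d [Q [surjQ kerQ]]] := saturated_quotient B.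
have QE v x : lin_comb x = v -> c v *m Q = x *m Q.
  move=> xv; apply/eqP; rewrite -subr_eq0 -mulmxBl; apply/eqP/kerQ/relB.
  by rewrite raddfB /= cK xv subrr.
have [|phi phiE] := @additive_of _ _ (fun v => c v *m Q).
  by move=> x y; rewrite -mulmxBl; apply: QE; rewrite raddfB /= !cK.
exists d, phi; split=> [y|v].
  by have [x xQ] := surjQ y; exists (lin_comb x); rewrite phiE (QE _ x).
by rewrite phiE -[in X in _ -> X](cK v) => /kerQ/torB.
Qed.

(** Lifting the unit vectors along [phi] defines a section, since the target is free. *)
Lemma fg_split : exists d (phi : {additive V -> 'rV[int]_d})
    (sg : {additive 'rV[int]_d -> V}),
  cancel sg phi /\ (forall v, phi v = 0 -> v \in @torsion V).
Proof.
have [d [phi [surj ker]]] := fg_free_quotient.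
have /choice[w wE] j := surj (delta_mx 0 j).
have [|sg sgE] := @additive_of 'rV[int]_d V (fun y => \sum_j w j *~ y 0 j).
  move=> x y; rewrite -sumrB; apply: eq_bigr => j _.
  by rewrite !mxE mulrzBr.
exists d, phi, sg; split=> // y.
rewrite sgE raddf_sum [RHS]row_sum_delta; apply: eq_bigr => j _.
by rewrite raddfMz wE -[in RHS](intz (y 0 j)) scaler_int.
Qed.

Lemma free_rank_quotient : exists phi : {additive V -> 'rV[int]_(free_rank V)},
  (forall y, exists v, phi v = y) /\ (forall v, phi v = 0 -> v \in @torsion V).
Proof.
have [d [phi [sg [sgK ker]]]] := fg_split.
have res_tor v : v - sg (phi v) \in @torsion V.
  by apply: ker; rewrite raddfB /= sgK subrr.
have [|f fE] := @additive_of V ('rV[int]_d * torsion_subgroup V)%type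
    (fun v => (phi v, TorsionElt (res_tor v))).
  move=> x y; congr pair; first by rewrite raddfB.
  by apply: val_inj; exact: (id_sub_is_zmod_morphism (sg \o phi)).
have fbij : bijective f.
  have phi_tor (t : torsion_subgroup V) : phi (t : V) = 0.
    exact/torsion_int_row/raddf_torsion/tvalP.
  exists (fun q : 'rV[int]_d * torsion_subgroup V => sg q.1 + (q.2 : V)).
    by move=> v; rewrite fE /= addrC subrK.
  move=> [y t]; rewrite fE /=.
  congr pair; first by rewrite raddfD /= sgK phi_tor addr0.
  by apply: val_inj; rewrite /= raddfD /= sgK phi_tor addr0 addrC addKr.
pose iso := [set d | exists f :
  {additive V -> ('rV[int]_d * torsion_subgroup V)%type}, bijective f].
(* The decomposition above makes [xget] return a valid exponent; the projection is then rebuilt from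
   the isomorphism [h] belonging to that exponent. *)
have [h [k hK kK]] : iso (free_rank V) by apply: xgetPex; exists d, f.
have [|psi psiE] := @additive_of V 'rV[int]_(free_rank V) (fun v => (h v).1).
  by move=> x y; rewrite raddfB.
exists psi; split=> [y|v]; first by exists (k (y, 0)); rewrite psiE kK.
rewrite psiE => hv1; have /torsionP[m m0 hvm] := tvalP (h v).2.
apply/torsionP; exists m => //; apply: (can_inj hK); rewrite raddfMn raddf0.
move: hv1 hvm; case: (h v) => y t /= -> tm.
have -> : ((0, t) : 'rV[int]_(free_rank V) * torsion_subgroup V) *+ m =
    (0 *+ m, t *+ m).
  by elim: (m) => // i IH; rewrite !mulrS IH.
by rewrite mul0rn; congr pair; apply: val_inj; rewrite raddfMn.
Qed.

Lemma torsion_retraction : exists tau : {additive V -> V},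
  (forall v, tau v \in @torsion V) /\ {in @torsion V, forall v, tau v = v}.
Proof.
have [d [phi [sg [sgK ker]]]] := fg_split.
have [|tau tauE] := @additive_of V V (fun v => v - sg (phi v)).
  exact: (id_sub_is_zmod_morphism (sg \o phi)).
exists tau; split=> v; rewrite tauE.
  by apply: ker; rewrite raddfB /= sgK subrr.
by move=> vt; rewrite [phi v]torsion_int_row ?raddf_torsion // raddf0 subr0.
Qed.

(** The retractions of the generators generate the torsion and are killed by a common [K], so
    coefficients can be reduced modulo [K]. *)
Lemma fg_torsion_finite : finite_set [set: torsion_subgroup V].
Proof.
have [tau [tau_tor tauK]] := torsion_retraction; have [s gen] := fgV.
have /choice[k kP] (i : 'I_(size s)) :
    exists k, (0 < k)%N /\ tau s`_i *+ k = 0.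
  by have /torsionP[k] := tau_tor s`_i; exists k.
pose K := (\prod_i k i)%N.
have K0 : (0 < K)%N by rewrite prodn_gt0 // => i; case: (kP i).
have tauKz (i : 'I_(size s)) : tau s`_i *+ K = 0.
  by rewrite /K (bigD1 i) //= mulrnA (kP i).2 mul0rn.
(* Only surjectivity of [F] matters; the default [0] spares proving that each sum is torsion. *)
pose F (f : {ffun 'I_(size s) -> 'I_K}) : torsion_subgroup V :=
  insubd 0 (\sum_(i < size s) tau s`_i *+ f i).
apply: (sub_finite_set _ (finite_image F (@finite_finset _ setT))) => x _.
have [c xE] := gen (x : V).
have modK i : (`|(c i %% K)%Z| < K)%N.
  by rewrite -ltz_nat gez0_abs ?modz_ge0 ?ltz_pmod // gt_eqF.
exists [ffun i => Ordinal (modK i)] => //; apply: val_inj.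
rewrite /F val_insubd.
suff -> : \sum_(i < size s) tau s`_i *+ [ffun i0 => Ordinal (modK i0)] i = (x : V).
  by rewrite (tvalP x).
rewrite -(tauK _ (tvalP x)) xE raddf_sum; apply: eq_bigr => i _.
rewrite ffunE /= raddfMz [in RHS](divz_eq (c i) K) mulrzDr mulrC mulrzA.
rewrite -[tau _ *~ K]/(tau _ *+ K) tauKz mul0rz add0r pmulrn.
by rewrite gez0_abs // modz_ge0 // gt_eqF.
Qed.

End FinitelyGenerated.

(** * Rank and independence *)

Section Rank.
Variables (n : nat) (M : realized_matroid n).
Implicit Types A B : {set 'I_n}.
Local Notation V := (ambient M).
Local Notation z := (elt M).
Local Notation quo A := \pi_(Quotient.quot (subgroup_gen (M := M) A)).
Local Notation ratm := (map_mx (intr : int -> rat)).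

Lemma subgroup_genP A (x : V) :
  reflect (exists c : 'I_n -> int, x = \sum_(i in A) z i *~ c i)
          (x \in subgroup_gen A).
Proof. exact: asboolP. Qed.

Lemma quo_eq0 A (x : V) : (quo A x == 0) = (x \in subgroup_gen A).
Proof.
by rewrite -[x in RHS]subr0 Quotient.idealrBE raddf0.
Qed.

Lemma module_fg A : finitely_generated (module M A).
Proof.
have [s gen] := ambient_fg M; exists [seq quo A x | x <- s] => x.
have [c xE] := gen (repr x).
exists (fun i => c (cast_ord (size_map _ s) i)).
rewrite -[LHS]reprK xE raddf_sum /=.
rewrite (reindex (cast_ord (size_map (quo A) s))) /=; last first.
  apply: onW_bij; apply: inj_card_bij; first exact: cast_ord_inj.
  by rewrite !card_ord size_map.
apply: eq_bigr => i _; rewrite raddfMz (nth_map 0) //=.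
by rewrite -(size_map (quo A)).
Qed.

Definition lin_indep A := forall c : 'I_n -> int,
  \sum_(i in A) z i *~ c i = 0 -> forall i, i \in A -> c i = 0.

Lemma extend_enum_val (T : nmodType) A (w : 'I_#|A| -> T) :
  exists c : 'I_n -> T, forall l, c (enum_val l) = w l.
Proof.
exists (fun i => \sum_(l | enum_val l == i) w l) => l.
by rewrite (big_pred1 l) // => k; rewrite (inj_eq enum_val_inj).
Qed.

Section FreeQuotient.
Variables (d : nat) (phi : {additive V -> 'rV[int]_d}).
Hypothesis phi_surj : forall y, exists v, phi v = y.
Hypothesis phi_ker : forall v, phi v = 0 -> v \in @torsion V.

Definition elt_mx A : 'M[rat]_(#|A|, d) :=
  \matrix_(l < #|A|) ratm (phi (z (enum_val l))).

Lemma lin_comb_elt_mx A (c : 'I_n -> int) :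
  ratm (phi (\sum_(i in A) z i *~ c i)) =
  (\row_l (c (enum_val l))%:~R) *m elt_mx A.
Proof.
rewrite big_enum_val raddf_sum mulmx_sum_row raddf_sum; apply: eq_bigr => l _.
rewrite rowK mxE !raddfMz /= scaler_int //.
Qed.

(** Rank-nullity over the rationals: the quotient map induces a surjection [D] between free
    quotients, whose kernel is the row space of [elt_mx A]. *)
Lemma free_rank_module A : (free_rank (module M A) + \rank (elt_mx A))%N = d.
Proof.
have [psi [psi_surj psi_ker]] := free_rank_quotient (module_fg A).
have /choice[w wE] j := phi_surj (delta_mx 0 j).
pose D := \matrix_(j < d) psi (quo A (w j)).
have psiE v : psi (quo A v) = phi v *m D.
  (* [v] minus the lift of its coordinates is killed by [phi], hence torsion, hence killed by
     [psi]. *)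
  have : psi (quo A (v - \sum_j w j *~ phi v 0 j)) = 0.
    apply/torsion_int_row/raddf_torsion/raddf_torsion/phi_ker.
    rewrite raddfB raddf_sum /= [X in X - _]row_sum_delta -sumrB big1 // => j _.
    by rewrite raddfMz wE -[X in X *: _]intz scaler_int subrr.
  pose f : {additive V -> _} := psi \o quo A.
  rewrite -[LHS]/(f _) -[X in _ -> X = _]/(f v) raddfB => /eqP.
  rewrite subr_eq0 => /eqP ->; rewrite raddf_sum mulmx_sum_row.
  apply: eq_bigr => j _.
  by rewrite rowK raddfMz -[X in X *: _]intz scaler_int.
have rankD : \rank (ratm D) = free_rank (module M A).
  apply/eqP/row_fullP.
  have /choice[v vE] k : exists v, phi v *m D = delta_mx 0 k.
    have [x xE] := psi_surj (delta_mx 0 k).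
    by exists (repr x); rewrite -psiE reprK.
  exists (ratm (\matrix_k phi (v k))); rewrite -map_mxM.
  suff -> : (\matrix_k phi (v k)) *m D = 1%:M by rewrite map_mx1.
  by apply/row_matrixP => k; rewrite row_mul rowK vE row1.
have kerD : (elt_mx A :=: kermx (ratm D))%MS.
  apply/eqmxP/andP; split.
    apply/sub_kermxP/row_matrixP => l.
    rewrite row_mul rowK row0 -map_mxM -psiE.
    suff /eqP -> : quo A (z (enum_val l)) == 0 by rewrite raddf0 map_mx0.
    rewrite quo_eq0; apply/subgroup_genP; exists (fun i => (i == enum_val l)%:Z).
    rewrite (bigD1 (enum_val l)) ?enum_valP //= eqxx big1 ?addr0 ?mulr1z //.
    by move=> i /andP[_ /negbTE ->]; rewrite mulr0z.
  (* A rational kernel vector, cleared of denominators and lifted to [v], is torsion in the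
     quotient, so a positive multiple of [v] lies in the subgroup generated by [A]. *)
  apply/row_subP => i; move: (row i _) (row_sub i (kermx (ratm D))) => u.
  move=> /sub_kermxP uD; have [k k0 [y yE]] := row_denominator u.
  have [v vE] := phi_surj y.
  have yD : y *m D = 0.
    apply: intr_map_mx_inj; rewrite map_mxM -yE -scalemxAl uD scaler0.
    by rewrite map_mx0.
  have /torsionP[m m0 vm] : quo A v \in @torsion _.
    by apply: psi_ker; rewrite psiE vE.
  have /subgroup_genP[c cE] : v *+ m \in subgroup_gen A.
    by rewrite -quo_eq0 raddfMn vm.
  have km0 : (k * m)%:R != 0 :> rat by rewrite pnatr_eq0 -lt0n muln_gt0 k0.
  rewrite -(eqmx_scale _ km0); apply/submxP.
  exists (\row_l (c (enum_val l))%:~R).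
  rewrite -lin_comb_elt_mx -cE mulnC natrM -scalerA yE -vE raddfMn.
  by apply/rowP => j; rewrite !mxE mulmxnE rmorphMn /= mulr_natl.
by rewrite kerD mxrank_ker rankD subnKC // -rankD rank_leq_row.
Qed.

(** A relation between images under [phi] holds in the group only up to torsion; a positive multiple
    makes it exact. *)
Lemma row_free_elt_mx A : row_free (elt_mx A) <-> lin_indep A.
Proof.
split=> [fr c c0 i iA|ind].
  have : \row_l (c (enum_val l))%:~R *m elt_mx A = 0.
    by rewrite -lin_comb_elt_mx c0 raddf0 map_mx0.
  move/eqP; rewrite mulmx_free_eq0 // => /eqP/rowP/(_ (enum_rank_in iA i)).
  by rewrite !mxE enum_rankK_in // => /eqP; rewrite intr_eq0 => /eqP.
rewrite -kermx_eq0; apply/eqP/row_matrixP => i; rewrite row0.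
move: (row i _) (row_sub i (kermx (elt_mx A))) => u /sub_kermxP uE.
have [k k0 [w wE]] := row_denominator u.
have [c cE] := extend_enum_val (fun l => w 0 l).
have : ratm (phi (\sum_(i in A) z i *~ c i)) = 0.
  rewrite lin_comb_elt_mx; have -> : \row_l (c (enum_val l))%:~R = k%:R *: u.
    by rewrite wE; apply/rowP => l; rewrite !mxE cE.
  by rewrite -scalemxAl uE scaler0.
rewrite -(map_mx0 (intr : {additive int -> rat})).
move/intr_map_mx_inj/phi_ker/torsionP => [m m0].
rewrite -sumrMnl => cm.
have w0 : w = 0.
  apply/rowP => l; rewrite -cE mxE.
  have /(ind _)/(_ (enum_val l) (enum_valP l)) :
      \sum_(i in A) z i *~ (c i *+ m) = 0.
    by rewrite -[RHS]cm; apply: eq_bigr => j _; rewrite mulrz_Mn.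
  by move/eqP; rewrite mulrn_eq0 eqn0Ngt m0 => /eqP.
apply: (scalerI (a := k%:R)); first by rewrite pnatr_eq0 -lt0n.
by rewrite wE w0 map_mx0 scaler0.
Qed.

End FreeQuotient.

(** By [free_rank_module] the drop of free rank from the empty set to [A] is the rank of
    [elt_mx phi A], which has #A rows. *)
Lemma independentP A : independent M A <-> lin_indep A.
Proof.
have [d [phi [surj ker]]] := fg_free_quotient (ambient_fg M).
have f0 := free_rank_module surj ker finset.set0.
have fA := free_rank_module surj ker A.
have r0 : \rank (elt_mx phi finset.set0) = 0%N.
  by apply/eqP; rewrite -leqn0 (leq_trans (rank_leq_row _)) ?cards0.
rewrite r0 addn0 in f0; rewrite -(row_free_elt_mx ker A) /independent f0 -{1}fA.
rewrite PoszD addrAC subrr add0r /row_free.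
by split=> [[->]|/eqP ->].
Qed.

Lemma independentS A B : B \subset A -> independent M A -> independent M B.
Proof.
move=> BA /independentP indA; apply/independentP => c c0 i iB.
have := indA (fun i => if i \in B then c i else 0) _ i (fintype.subsetP BA i iB).
rewrite iB; apply; rewrite -[RHS]c0 big_mkcond [RHS]big_mkcond.
apply: eq_bigr => j _; case: ifP => [_|/negbT jA]; first by case: ifP.
by rewrite ifN //; apply: contraNN jA => /(fintype.subsetP BA).
Qed.

End Rank.

(** * The poset of torsions *)

Section TorsionPoset.
Variables (n : nat) (M : realized_matroid n) (R : realType).
Implicit Types A B : {set 'I_n}.
Local Notation V := (ambient M).
Local Notation quo A := \pi_(Quotient.quot (subgroup_gen (M := M) A)).

Lemma subgroup_gen_subset A B (v : V) :
  B \subset A -> v \in subgroup_gen B -> v \in subgroup_gen A.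
Proof.
move=> BA /subgroup_genP[c ->]; apply/subgroup_genP.
exists (fun i => if i \in B then c i else 0).
rewrite big_mkcond [RHS]big_mkcond; apply: eq_bigr => i _.
case: ifP => [/(fintype.subsetP BA) -> //|_].
by rewrite mulr0z if_same.
Qed.

(** All saturations sit inside [V], so characters of different groups [tors M A] can be compared as
    functions on [V], without dependent types. *)
Definition saturation A : {pred V} := fun v => quo A v \in @torsion (module M A).

Lemma saturationE A (v : V) :
  (v \in saturation A) = (quo A v \in @torsion (module M A)).
Proof. by []. Qed.

Lemma saturationP A (v : V) :
  reflect (exists2 k : nat, (0 < k)%N & v *+ k \in subgroup_gen A)
          (v \in saturation A).
Proof.
apply: (iffP (torsionP _)) => -[k k0].
  by move=> vk; exists k => //; rewrite -quo_eq0 raddfMn vk.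
by rewrite -quo_eq0 raddfMn => /eqP; exists k.
Qed.

Lemma saturation_zmod_closed A : zmod_closed (saturation A).
Proof.
split=> [|v w]; rewrite ?saturationE; first by rewrite raddf0 rpred0.
by rewrite raddfB; exact: rpredB.
Qed.

HB.instance Definition _ A := GRing.isZmodClosed.Build V (saturation A)
  (saturation_zmod_closed A).

Lemma saturation_subset A B (v : V) :
  B \subset A -> v \in saturation B -> v \in saturation A.
Proof.
move=> BA /saturationP[k k0 vk]; apply/saturationP; exists k => //.
exact: subgroup_gen_subset vk.
Qed.

Lemma subgroup_gen_saturation A (v : V) :
  v \in subgroup_gen A -> v \in saturation A.
Proof. by move=> vA; apply/saturationP; exists 1%N. Qed.

(* A character of the torsion of [module M A] seen on [V]: the pullback to the
   saturation of the subgroup generated by [A], and [0] elsewhere. *)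
Definition char_fun A (h : dual R (tors M A)) (v : V) : R[i] :=
  if insub (quo A v) is Some t then h t else 0.

Lemma char_fun_sat A (h : dual R (tors M A)) v (vA : v \in saturation A) :
  char_fun h v = h (TorsionElt vA).
Proof. by rewrite /char_fun insubT. Qed.

Lemma char_fun_repr A (h : dual R (tors M A)) (t : tors M A) :
  repr (Defs.tval t) \in saturation A /\ h t = char_fun h (repr (Defs.tval t)).
Proof.
have tA : repr (Defs.tval t) \in saturation A.
  by rewrite saturationE reprK tvalP.
split=> //; rewrite (char_fun_sat _ tA); congr (h _); apply: val_inj.
by rewrite /= reprK.
Qed.

Lemma char_fun_neq0 A (h : dual R (tors M A)) v :
  v \in saturation A -> char_fun h v != 0.
Proof. by move=> vA; rewrite (char_fun_sat _ vA) dual_neq0. Qed.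

Lemma char_funD A (h : dual R (tors M A)) v w :
  v \in saturation A -> w \in saturation A ->
  char_fun h (v + w) = char_fun h v * char_fun h w.
Proof.
move=> vA wA; rewrite (char_fun_sat _ (rpredD vA wA)).
rewrite (char_fun_sat _ vA) (char_fun_sat _ wA) -dualD; congr (h _).
by apply: val_inj; rewrite /= raddfD.
Qed.

Lemma char_fun_gen A (h : dual R (tors M A)) v :
  v \in subgroup_gen A -> char_fun h v = 1.
Proof.
move=> vA; rewrite (char_fun_sat _ (subgroup_gen_saturation vA)).
rewrite -[RHS](dual0 h); congr (h _); apply: val_inj => /=.
by apply/eqP; rewrite quo_eq0.
Qed.

Lemma char_fun_inj A (h k : dual R (tors M A)) :
  {in saturation A, char_fun h =1 char_fun k} -> h = k.
Proof.
move=> hk; apply: dual_eqP => t.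
have [tA ->] := char_fun_repr h t; have [_ ->] := char_fun_repr k t.
exact: hk.
Qed.

(** Triviality on the subgroup makes [F] constant on its cosets in the saturation, so values at
    representatives define the character. *)
Lemma char_fun_exists A (F : V -> R[i]) :
  {in saturation A, forall v, F v != 0} ->
  {in saturation A &, {morph F : v w / v + w >-> v * w}} ->
  {in subgroup_gen A, forall v, F v = 1} ->
  exists h : dual R (tors M A), {in saturation A, char_fun h =1 F}.
Proof.
move=> F0 FD F1.
have Frepr v x : v \in saturation A -> quo A v = x -> F (repr x) = F v.
  move=> vA <-.
  have genA : repr (quo A v) - v \in subgroup_gen A.
    by rewrite Quotient.idealrBE reprK.
  have := FD _ _ (subgroup_gen_saturation genA) vA.
  by rewrite subrK (F1 _ genA) mul1r.
have reprA (t : tors M A) : repr (Defs.tval t) \in saturation A.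
  by rewrite saturationE reprK tvalP.
have h0 (t : tors M A) : F (repr (Defs.tval t)) != 0 by apply: F0.
have hD (t u : tors M A) : F (repr (Defs.tval (t + u))) =
    F (repr (Defs.tval t)) * F (repr (Defs.tval u)).
  by rewrite -FD //; apply: Frepr; rewrite ?rpredD // raddfD /= !reprK.
exists (Dual h0 hD) => v vA.
by rewrite (char_fun_sat _ vA) /=; apply: Frepr.
Qed.

Lemma char_fun_restrict A B (h : dual R (tors M A)) : B \subset A ->
  exists k : dual R (tors M B), {in saturation B, char_fun k =1 char_fun h}.
Proof.
move=> BA; apply: char_fun_exists => [v vB|v w vB wB|v vB].
- exact/char_fun_neq0/(saturation_subset BA).
- by apply: char_funD; apply: (saturation_subset BA).
- exact/char_fun_gen/(subgroup_gen_subset BA).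
Qed.

Local Notation GrM := (Gr M R).
Implicit Types x y : GrM.

Definition gr_fun x : V -> R[i] := char_fun (gr_char x).

Lemma gr_eqP x y : gr_set x = gr_set y ->
  {in saturation (gr_set x), gr_fun x =1 gr_fun y} -> x = y.
Proof.
case: x y => [A h Ai] [B k Bi] /= AB; subst B => hk.
have {}hk : h = k by exact: char_fun_inj.
by subst k; congr MkGr; exact: Prop_irrelevance.
Qed.

(** This removes the transitive closure from later arguments. In the converse direction, the missing
    elements are added one at a time. *)
Lemma gr_leP x y : (x <= y)%O <->
  gr_set x \subset gr_set y /\ {in saturation (gr_set x), gr_fun y =1 gr_fun x}.
Proof.
split=> [/asboolP|[]].
  elim=> {x y} [_ _ [A b h l Abi Ai bA <-]|x|x y w _ [xy hxy] _ [yw hyw]].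
  - split=> [|v vA]; first exact: finset.subsetUr.
    have vbA := saturation_subset (finset.subsetUr [set b]%SET A) vA.
    rewrite /gr_fun /= (char_fun_sat _ vbA) (char_fun_sat _ vA) /=.
    by congr (h _); apply: val_inj; rewrite /= proj_pi.
  - by split.
  - split=> [|v vx]; first exact: fintype.subset_trans xy yw.
    by rewrite hyw ?hxy // (saturation_subset xy).
have [k] := ubnP #|(gr_set y :\: gr_set x)%SET|.
elim: k x => // k IH x card_lt xy hxy.
have [yx0|[b]] := finset.set_0Vmem (gr_set y :\: gr_set x)%SET.
  have sxy : gr_set x = gr_set y.
    by apply/eqP; rewrite finset.eqEsubset xy -finset.setD_eq0 yx0 eqxx.
  by have -> : x = y by apply: gr_eqP => // v /hxy ->.
rewrite inE => /andP[bx by_].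
have bxy : b |: gr_set x \subset gr_set y.
  by rewrite finset.subUset finset.sub1set by_.
(* The next element of the chain carries a restriction of the character of [y], so it stays below
   [y]. *)
have [h hE] := char_fun_restrict (gr_char y) bxy.
have bxi : independent M (b |: gr_set x) := independentS bxy (gr_indep y).
apply: (@le_trans _ _ (MkGr h bxi)).
  apply/asboolP/rt_step; case: x bx xy hxy bxy h hE bxi {card_lt} => A l Ai /=.
  move=> bA Ay hl bAy h hE bAi; apply: Covers => //; apply: char_fun_inj => v vA.
  have vbA := saturation_subset (finset.subsetUr [set b]%SET A) vA.
  rewrite -[RHS]hl // -[RHS]hE // (char_fun_sat _ vbA) (char_fun_sat _ vA) /=.
  by congr (h _); apply: val_inj; rewrite /= proj_pi.
apply: IH => //=; last by move=> v /hE hv; rewrite /gr_fun hv.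
rewrite -ltnS; apply: leq_trans card_lt; rewrite ltnS.
apply: proper_card; apply/properP; split.
  by rewrite finset.setDS // finset.subsetUr.
by exists b; rewrite !inE ?bx ?by_ // eqxx.
Qed.

End TorsionPoset.

(** * Intervals and links *)

Section LinkStructure.
Variables (n : nat) (M : realized_matroid n) (R : realType).
Implicit Types A B : {set 'I_n}.
Local Notation GrM := (Gr M R).
Implicit Types x y w o s : GrM.

Lemma gr_finite : finite_set [set: GrM].
Proof.
(* Dependent sets get the junk value [gr_id], so each [A] contributes the image of a finite dual
   group. *)
pose mk A (h : dual R (tors M A)) : GrM :=
  if pselect (independent M A) is left Ai then MkGr h Ai else gr_id M R.
have fin A : finite_set (range (@mk A)).
  exact/finite_image/dual_finite/fg_torsion_finite/module_fg.
apply: (sub_finite_set _ (bigcup_finite (@finite_finset _ setT)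
  (fun A _ => fin A))) => -[A h Ai] _.
exists A => //; exists h => //; rewrite /mk; case: pselect => // Ai'.
by congr MkGr; exact: Prop_irrelevance.
Qed.

Lemma gr_restrict x B : B \subset gr_set x ->
  exists2 y, gr_set y = B & (y <= x)%O.
Proof.
move=> Bx; have [h hE] := char_fun_restrict (gr_char x) Bx.
exists (MkGr h (independentS Bx (gr_indep x))) => //.
by apply/gr_leP; split=> // v /hE hv; rewrite /gr_fun hv.
Qed.

(** Both characters restrict that of [x], hence agree as soon as the sets are nested. *)
Lemma gr_le_below x y w : (y <= x)%O -> (w <= x)%O ->
  (gr_set y \subset gr_set w) = (y <= w)%O.
Proof.
move=> /gr_leP[_ yx] /gr_leP[_ wx]; apply/idP/idP => [yw|/gr_leP[] //].
apply/gr_leP; split=> // v vy.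
by rewrite -yx // wx // (saturation_subset yw).
Qed.

Lemma gr_eq_below x y w : (y <= x)%O -> (w <= x)%O ->
  gr_set y = gr_set w -> y = w.
Proof.
move=> yx wx yw; apply: le_anti.
by rewrite -(gr_le_below yx wx) -(gr_le_below wx yx) yw fintype.subxx.
Qed.

Lemma interval_boolean o s : gr_set o = finset.set0 -> link o s ->
  boolean (interval_in (link o) o s).
Proof.
move=> o0 os; exists #|gr_set s|.
pose f x := [set l : 'I_#|gr_set s| | enum_val l \in gr_set x]%SET.
have f_le x y : (x <= s)%O -> (y <= s)%O -> (f x \subset f y) = (x <= y)%O.
  move=> xs ys; rewrite -(gr_le_below xs ys).
  apply/fintype.subsetP/fintype.subsetP => [fxy i ix|xy l]; last first.
    by rewrite !inE; exact: xy.
  have is_ : i \in gr_set s by have /gr_leP[/fintype.subsetP sx _] := xs; exact: sx.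
  have := fxy (enum_rank_in is_ i).
  by rewrite !inE enum_rankK_in //; apply.
exists f; last by move=> x y [_ _ xs] [_ _ ys]; exact: f_le.
split=> [//|x y /set_mem[_ _ xs] /set_mem[_ _ ys] fxy|B _].
  by apply: le_anti; rewrite -(f_le x y) // -(f_le y x) // fxy fintype.subxx.
have Bs : (enum_val @: B)%SET \subset gr_set s.
  by apply/fintype.subsetP => _ /finset.imsetP[l _ ->]; exact: enum_valP.
have [y yB ys] := gr_restrict Bs.
have oy : (o <= y)%O by rewrite -(gr_le_below os ys) o0 finset.sub0set.
exists y; first by split.
by apply/finset.setP => l; rewrite inE yB (finset.mem_imset _ _ enum_val_inj).
Qed.

Lemma link_simplicial o : gr_set o = finset.set0 -> simplicial (link o).
Proof.
move=> o0; split; first exact: sub_finite_set gr_finite.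
exists o; split.
- by split=> [|y oy yo]; [exact: lexx|apply: le_anti; rewrite yo].
- by move=> o' [oo' min]; apply/esym/min => //; exact: lexx.
- by move=> s os; exact: interval_boolean.
Qed.

Lemma link_disjoint_union (I : Type) (o : I -> GrM) : injective o ->
  (forall i, gr_set (o i) = finset.set0) ->
  (forall x, gr_set x = finset.set0 -> exists i, o i = x) ->
  poset_disjoint_union (fun i => link (o i)).
Proof.
move=> o_inj o0 o_surj.
(* The bottoms [o i] and [o j] both lie below [y] and have the same empty set, so they coincide. *)
have comp i j x y : link (o i) x -> link (o j) y -> (x <= y)%O -> i = j.
  move=> ix jy xy; apply: o_inj; apply: (gr_eq_below (le_trans ix xy) jy).
  by rewrite !o0.
split=> //.
  rewrite -subTset => x _.
  have [y y0 yx] := gr_restrict (finset.sub0set (gr_set x)).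
  by have [i iy] := o_surj y y0; exists i => //; rewrite /link /= iy.
by move=> i j _ _ [x [ix jx]]; exact: comp ix jx (lexx x).
Qed.

End LinkStructure.

(** * Isomorphism of the links *)

Section Twist.
Variables (n : nat) (M : realized_matroid n) (R : realType).
Implicit Types A B : {set 'I_n}.
Local Notation V := (ambient M).
Local Notation z := (elt M).
Local Notation GrM := (Gr M R).
Implicit Types x y o : GrM.

(** The first three conditions let multiplication by [psi A] preserve characters of [tors M A]; the
    last makes it respect the order. *)
Record character_system (psi : {set 'I_n} -> V -> R[i]) : Prop := {
  system_neq0 : forall A, independent M A ->
    {in saturation A, forall v, psi A v != 0};
  systemD : forall A, independent M A ->
    {in saturation A &, {morph psi A : v w / v + w >-> v * w}};
  system_gen : forall A, independent M A ->
    {in subgroup_gen A, forall v, psi A v = 1};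
  system_restrict : forall A B, B \subset A -> independent M A ->
    {in saturation B, psi A =1 psi B} }.

Lemma system_inv psi : character_system psi ->
  character_system (fun A v => (psi A v)^-1).
Proof.
case=> s0 sD s1 sr; split=> [A Ai v vA|A Ai v w vA wA|A Ai v vA|A B BA Ai v vB].
- by rewrite invr_eq0 s0.
- by rewrite sD // invfM.
- by rewrite s1 // invr1.
- by rewrite (sr A B).
Qed.

Lemma gr_twist psi : character_system psi -> exists T : GrM -> GrM,
  forall x, gr_set (T x) = gr_set x /\
    {in saturation (gr_set x), forall v,
      gr_fun (T x) v = gr_fun x v * psi (gr_set x) v}.
Proof.
case=> s0 sD s1 _; suff /choice[T TP] x : exists y, gr_set y = gr_set x /\
    {in saturation (gr_set x), forall v,
      gr_fun y v = gr_fun x v * psi (gr_set x) v} by exists T.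
have xi := gr_indep x.
have [v vA|v w vA wA|v vA|h hE] := @char_fun_exists _ M R (gr_set x)
    (fun v => gr_fun x v * psi (gr_set x) v); last by exists (MkGr h xi).
- by rewrite mulf_neq0 ?s0 ?char_fun_neq0.
- by rewrite sD // /gr_fun char_funD // mulrACA.
- by rewrite s1 // /gr_fun char_fun_gen // mulr1.
Qed.

(** Multiplications by the system and by its inverse are mutually inverse order-preserving maps of
    the whole poset, and the former sends [o'] to [o]. *)
Lemma link_twist psi o o' : character_system psi ->
  gr_set o = finset.set0 -> gr_set o' = finset.set0 ->
  {in saturation finset.set0, forall v,
    gr_fun o v = gr_fun o' v * psi finset.set0 v} ->
  order_iso (link o) (link o').
Proof.
move=> sys o0 o'0 oo'.
have [T TP] := gr_twist (system_inv sys); have [S SP] := gr_twist sys.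
have psi_neq0 x v : v \in saturation (gr_set x) -> psi (gr_set x) v != 0.
  by move=> vx; exact: (system_neq0 sys (gr_indep x)).
have TK : cancel T S.
  move=> x; have [Tx TxE] := TP x; have [STx STxE] := SP (T x).
  apply: gr_eqP; rewrite STx ?Tx // => v vx.
  by rewrite STxE Tx // TxE // divfK // psi_neq0.
have SK : cancel S T.
  move=> x; have [Sx SxE] := SP x; have [TSx TSxE] := TP (S x).
  apply: gr_eqP; rewrite TSx ?Sx // => v vx.
  by rewrite TSxE Sx // SxE // mulfK // psi_neq0.
have T_le x y : (x <= y)%O -> (T x <= T y)%O.
  move=> /gr_leP[xy hxy]; have [Tx TxE] := TP x; have [Ty TyE] := TP y.
  apply/gr_leP; rewrite Tx Ty; split=> // v vx.
  rewrite TxE // TyE ?(saturation_subset xy) // hxy //.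
  by rewrite (system_restrict sys xy (gr_indep y)).
have S_le x y : (x <= y)%O -> (S x <= S y)%O.
  move=> /gr_leP[xy hxy]; have [Sx SxE] := SP x; have [Sy SyE] := SP y.
  apply/gr_leP; rewrite Sx Sy; split=> // v vx.
  rewrite SxE // SyE ?(saturation_subset xy) // hxy //.
  by rewrite (system_restrict sys xy (gr_indep y)).
have So' : S o' = o.
  have [So SoE] := SP o'; apply: gr_eqP; rewrite So o'0 ?o0 // => v v0.
  by rewrite SoE ?o'0 // oo'.
exists T.
  split=> [x /T_le|x y _ _ /(can_inj TK) //|y /S_le].
  - by rewrite -[in T o]So' SK.
  - by rewrite So' => oSy; exists (S y) => //; rewrite SK.
by move=> x y _ _; apply/idP/idP => [/S_le|/T_le //]; rewrite !TK.
Qed.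

(** [r] sums the rational coordinates c_i / k with weights [a]; linear independence removes the
    dependence on [k] and [c]. *)
Lemma weighted_coordinates (a : 'I_n -> R) A : independent M A ->
  exists r : V -> R, forall v k (c : 'I_n -> int), (0 < k)%N ->
    v *+ k = \sum_(i in A) z i *~ c i ->
    r v = (\sum_(i in A) a i *~ c i) / k%:R.
Proof.
move=> /independentP indA.
suff /choice[r rP] v : exists r, forall k (c : 'I_n -> int), (0 < k)%N ->
    v *+ k = \sum_(i in A) z i *~ c i ->
    r = (\sum_(i in A) a i *~ c i) / k%:R by exists r.
have [/saturationP[k k0 /subgroup_genP[c vk]]|vNA] := boolP (v \in saturation A);
    last first.
  (* Outside the saturation no such [k] and [c] exist, so any value serves. *)
  exists 0 => k c k0 vk; case/negP: vNA; apply/saturationP; exists k => //.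
  by apply/subgroup_genP; exists c.
exists ((\sum_(i in A) a i *~ c i) / k%:R) => l d l0 vl.
have cd i : i \in A -> c i *+ l = d i *+ k.
  move=> iA; apply/eqP; rewrite -subr_eq0; apply/eqP.
  apply: (indA (fun i => c i *+ l - d i *+ k)) => //.
  under eq_bigr do rewrite mulrzBr !mulrz_Mn.
  by rewrite sumrB !sumrMnl -vk -vl -!mulrnA mulnC subrr.
apply/eqP; rewrite eqr_div ?pnatr_eq0 -?lt0n // !mulr_natr -!sumrMnl.
apply/eqP/eq_bigr => i iA.
by rewrite -!mulrz_Mn cd.
Qed.

(* The group elements [z i] need not be killed by a character of [V] extending
   the one of [o]; the correcting phase is linear in the rational coordinates
   along [A], which are compatible for nested independent sets. *)
Lemma system_exists o : gr_set o = finset.set0 ->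
  exists2 psi, character_system psi &
    {in saturation finset.set0, psi finset.set0 =1 gr_fun o}.
Proof.
move=> o0; pose F := gr_fun o.
have [tau [tau_tor tauK]] := torsion_retraction (ambient_fg M).
have tor_sat v : v \in @torsion V -> v \in saturation (gr_set o).
  move=> /torsionP[k k0 vk]; apply/saturationP; exists k => //.
  by rewrite vk rpred0.
have sat_tor v : v \in saturation (M := M) finset.set0 -> v \in @torsion V.
  move=> /saturationP[k k0 /subgroup_genP[c vk]]; apply/torsionP; exists k => //.
  by rewrite vk big_set0.
have FD v w : F (tau (v + w)) = F (tau v) * F (tau w).
  by rewrite raddfD /F /gr_fun char_funD //; exact: tor_sat.
have F0 v : F (tau v) != 0 by apply: char_fun_neq0; exact: tor_sat.
have F1 : F (tau 0) = 1.
  by apply: (mulfI (F0 0)); rewrite -FD addr0 mulr1.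
have FMn v k : F (tau (v *+ k)) = F (tau v) ^+ k.
  by elim: k => [|k IH]; rewrite ?mulr0n ?expr0 // mulrS exprS FD IH.
(* [tau (z i)] has finite order, so its value under [F] is a root of unity. *)
have /choice[a aE] i : exists a, expi a = F (tau (z i)) :> R[i].
  have /torsionP[k k0 zk] := tau_tor (z i).
  apply: (root_of_unity_expi k0); rewrite -FMn raddfMn zk -[0](raddf0 tau).
  exact: F1.
have Fcomb A (c : 'I_n -> int) : F (tau (\sum_(i in A) z i *~ c i)) =
    expi (\sum_(i in A) a i *~ c i).
  apply: (big_ind2 (fun v r => F (tau v) = expi r)).
  - by rewrite F1 expi0.
  - by move=> v r w t vr wt; rewrite FD expiD vr wt.
  - have FN v : F (tau (- v)) = (F (tau v))^-1.
      by apply: (mulfI (F0 v)); rewrite -FD subrr F1 divff.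
    have nat_case i k : F (tau (z i *+ k)) = expi (a i *+ k).
      elim: k => [|k IH]; first by rewrite !mulr0n F1 expi0.
      by rewrite !mulrS FD expiD IH aE.
    move=> i _; case: (c i) => k; first exact: nat_case.
    by rewrite NegzE !mulrNz FN expiN; congr (_^-1); exact: nat_case.
have /choice[r rP] A : exists r : V -> R, independent M A ->
    forall v k (c : 'I_n -> int), (0 < k)%N ->
    v *+ k = \sum_(i in A) z i *~ c i ->
    r v = (\sum_(i in A) a i *~ c i) / k%:R.
  have [/(weighted_coordinates a)[r rP]|NA] := pselect (independent M A).
    by exists r.
  by exists (fun=> 0).
exists (fun A v => F (tau v) * expi (- r A v)); last first.
  move=> v v0; have vt := sat_tor v v0; have /torsionP[k k0 vk] := vt.
  rewrite tauK // (rP _ (independent0 M) v k (fun=> 0)) ?vk ?big_set0 //.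
  by rewrite mul0r oppr0 expi0 mulr1.
split=> [A Ai v vA|A Ai v w|A Ai v|A B BA Ai v].
- by rewrite mulf_neq0 ?expi_neq0.
- move=> /saturationP[k k0 /subgroup_genP[c vk]].
  move=> /saturationP[l l0 /subgroup_genP[d wl]].
  suff -> : r A (v + w) = r A v + r A w by rewrite FD opprD expiD mulrACA.
  rewrite (rP _ Ai v k c) // (rP _ Ai w l d) //.
  (* Over the common denominator [k * l] the coordinates add. *)
  rewrite (rP _ Ai (v + w) (k * l)%N (fun i => c i *+ l + d i *+ k)).
  + rewrite addf_div ?pnatr_eq0 -?lt0n // natrM; congr (_ / _).
    rewrite !mulr_natr -!sumrMnl -big_split; apply: eq_bigr => i _ /=.
    by rewrite mulrzDr !mulrz_Mn.
  + by rewrite muln_gt0 k0.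
  + rewrite mulrnDl mulrnA vk mulnC mulrnA wl -!sumrMnl -big_split.
    apply: eq_bigr => i _ /=.
    by rewrite mulrzDr !mulrz_Mn.
(* With denominator 1 the phase is the inverse of the value given by [Fcomb]. *)
- move=> /subgroup_genP[c vE]; rewrite (rP _ Ai v 1%N c) // {1}vE Fcomb divr1.
  by rewrite -expiD subrr expi0.
- move=> /saturationP[k k0 /subgroup_genP[c vk]].
  suff -> : r A v = r B v by [].
  (* Coordinates along [B], extended by 0, are coordinates along [A]. *)
  have ext (W : zmodType) (u : 'I_n -> W) : \sum_(i in B) u i *~ c i =
      \sum_(i in A) u i *~ (if i \in B then c i else 0).
    rewrite big_mkcond [RHS]big_mkcond; apply: eq_bigr => i _.
    case: ifP => [/(fintype.subsetP BA) -> //|_].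
    by rewrite mulr0z if_same.
  rewrite (rP _ (independentS BA Ai) v k c) // ext.
  by apply: (rP _ Ai) => //; rewrite vk ext.
Qed.

Lemma link_iso o :
  gr_set o = finset.set0 -> order_iso (link o) (link (gr_id M R)).
Proof.
move=> o0; have [psi sys psi0] := system_exists o0.
apply: (link_twist sys) => // v v0; rewrite psi0 //.
by rewrite /gr_fun (char_fun_sat (gr_char (gr_id M R)) v0) mul1r.
Qed.

End Twist.

Theorem theoremA (R : realType) (n : nat) (M : realized_matroid n) :
  exists m : nat,
    ([set: tors M finset.set0] #= `I_m) /\
    exists P : 'I_m -> set (Gr M R),
      [/\ poset_disjoint_union P,
          forall k, simplicial (P k) &
          forall k, order_iso (P k) (link (gr_id M R))].
Proof.
have /finite_setP[m card_m] := fg_torsion_finite (module_fg M finset.set0).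
exists m; split=> //.
have [chi [idc chiK idcK]] := dual_enumeration_card R card_m.
pose o k := MkGr (chi k) (independent0 M).
(* Passing through [gr_fun] avoids inverting an equality of dependent records. *)
have char_inj (h h' : dual R (tors M finset.set0)) :
    MkGr h (independent0 M) = MkGr h' (independent0 M) -> h = h'.
  move=> hh'; apply: char_fun_inj => v _.
  by rewrite -[LHS]/(gr_fun (MkGr h (independent0 M)) v) hh'.
exists (fun k => link (o k)); split=> [|k|k].
- apply: link_disjoint_union => //.
    by move=> i j /char_inj/(can_inj chiK).
  case=> A h Ai /= A0; subst A; exists (idc h).
  by rewrite /o idcK; congr MkGr; exact: Prop_irrelevance.
- exact: link_simplicial.
- exact: link_iso.
Qed.
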